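(* If $D$ is a Deming graph, then $\alpha(D)=\nu(D)-1$.
   Context: Graphs are finite and simple. For a graph $H$, $n(H)$ is its order, $\alpha(H)$ its independence number and $\nu(H)$ its matching number. $H$ is KE (König-Egerváry) if $\alpha(H)+\nu(H)=n(H)$; the null graph is KE. $T$ is the graph on 6 vertices consisting of two vertex-disjoint triangles together with a single edge joining a vertex of one to a vertex of the other. An even subdivision of a graph is obtained by subdividing each edge an even number (possibly zero) of times, i.e. replacing each edge by a path of odd length. A Deming-$K_4$ graph is a graph $K$ that contains a spanning even subdivision of $K_4$ and such that $K-\{x,y\}$ (delete both vertices) is KE for every edge $xy$ of $K$ that lies in at least one perfect matching of $K$. A Deming-BP graph is a graph $B$ that contains a spanning even subdivision of $T$ and such that $B-\{x,y\}$ is KE for every edge $xy$ of $B$ that lies in at least one perfect matching of $B$. A Deming graph is a graph that is a Deming-$K_4$ graph or a Deming-BP graph. *)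

(* Defs.v *)
From HB Require Import structures.
From mathcomp Require Import all_boot.

Set Implicit Arguments.
Unset Strict Implicit.
Unset Printing Implicit Defensive.

Record sgraph := SGraph {
  vertex :> finType;
  adj : rel vertex;
  adj_sym : symmetric adj;
  adj_irrefl : irreflexive adj }.

Definition graph_order (G : sgraph) : nat := #|G|.

Definition independent (G : sgraph) (A : {set G}) : bool :=
  [forall x in A, forall y in A, ~~ adj x y].

Definition alpha (G : sgraph) : nat := \max_(A : {set G} | independent A) #|A|.

(* A matching is a set of edges, an edge being the pair of its ends. *)
Definition is_edge (G : sgraph) (e : {set G}) : bool :=
  [exists x, exists y, adj x y && (e == [set x; y])].

Definition matching (G : sgraph) (M : {set {set G}}) : bool :=
  [forall e in M, is_edge e] && trivIset M.

Definition nu (G : sgraph) : nat :=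
  \max_(M : {set {set G}} | matching M) #|M|.

Definition perfect_matching (G : sgraph) (M : {set {set G}}) : bool :=
  matching M && (cover M == [set: G]).

Definition KE (G : sgraph) : Prop := alpha G + nu G = graph_order G.

Section Induced.
Variables (G : sgraph) (A : {set G}).

Definition induced_adj : rel {x : G | x \in A} :=
  [rel x y : {x : G | x \in A} | adj (val x) (val y)].

Lemma induced_adj_sym : symmetric induced_adj.
Proof. by move=> x y; apply: adj_sym. Qed.

Lemma induced_adj_irrefl : irreflexive induced_adj.
Proof. by move=> x; apply: adj_irrefl. Qed.

Definition induced : sgraph := SGraph induced_adj_sym induced_adj_irrefl.
End Induced.

Definition delete (G : sgraph) (A : {set G}) : sgraph := induced (~: A).

Definition K4_adj : rel 'I_4 := [rel i j : 'I_4 | i != j].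

Lemma K4_adj_sym : symmetric K4_adj.
Proof. by move=> i j; congr negb; apply: eq_sym. Qed.

Lemma K4_adj_irrefl : irreflexive K4_adj.
Proof. by move=> i; apply/negbF/eqP. Qed.

Definition K4 : sgraph := SGraph K4_adj_sym K4_adj_irrefl.

(* Triangles {0, 1, 2} and {3, 4, 5}, joined by the edge {2, 3}. *)
Definition T_adj : rel 'I_6 :=
  [rel i j : 'I_6 | [|| (i != j) && ((i < 3) == (j < 3)),
                         (val i == 2) && (val j == 3)
                       | (val i == 3) && (val j == 2)]].

Lemma T_adj_sym : symmetric T_adj.
Proof.
move=> i j; congr orb; first by congr (~~ _ && _); apply: eq_sym.
by rewrite orbC; congr orb; apply: andbC.
Qed.

Lemma T_adj_irrefl : irreflexive T_adj.
Proof. by move=> [[|[|[|[|[|[|i]]]]]] Hi]. Qed.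

Definition T : sgraph := SGraph T_adj_sym T_adj_irrefl.

(* [S] is [G] with every edge replaced by a path of odd length. The map [b]
   embeds the vertices of [G]; for an edge [uv], [p u v] lists the new vertices
   placed on it, in order from [b u] to [b v], so that the replacing path has
   [(size (p u v)).+1] edges. The edge [uv] occurs as both [(u, v)] and [(v, u)],
   whose lists are the reverse of each other. *)
Definition even_subdivision (G S : sgraph) : Prop :=
  exists (b : G -> S) (p : G -> G -> seq S),
    [/\ injective b,
        forall u v, adj u v ->
          [/\ ~~ odd (size (p u v)), uniq (p u v), p v u = rev (p u v)
            & forall w, b w \notin p u v],
        forall u v u' v', adj u v -> adj u' v' ->
          forall x, x \in p u v -> x \in p u' v' ->
            (u', v') = (u, v) \/ (u', v') = (v, u),
        forall x, (exists u, x = b u) \/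
                  (exists u v, adj u v /\ x \in p u v)
      & forall x y, adj x y <->
          exists u v, adj u v /\ infix [:: x; y] (b u :: rcons (p u v) (b v))].

Definition spanning_subgraph (S K : sgraph) : Prop :=
  exists f : S -> K, bijective f /\ forall x y, adj x y -> adj (f x) (f y).

Definition has_spanning_even_subdivision (G K : sgraph) : Prop :=
  exists S : sgraph, even_subdivision G S /\ spanning_subgraph S K.

Definition KE_deletions (K : sgraph) : Prop :=
  forall x y : K, adj x y ->
    (exists2 M : {set {set K}}, perfect_matching M & [set x; y] \in M) ->
    KE (delete [set x; y]).

Definition Deming_K4 (K : sgraph) : Prop :=
  has_spanning_even_subdivision K4 K /\ KE_deletions K.

Definition Deming_BP (B : sgraph) : Prop :=
  has_spanning_even_subdivision T B /\ KE_deletions B.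

Definition Deming (D : sgraph) : Prop := Deming_K4 D \/ Deming_BP D.

(* Main.v *)
Require Import Defs.
From mathcomp Require Import all_boot all_algebra.
From mathcomp Require Import zify.

(** Why the theorem is true. Let [n] be the order of [D].

    In both cases the graph [G] being subdivided ([K4] or [T]) has a perfect
    matching. Replacing an edge by a path of odd length turns it into a path
    with an even number of vertices, and leaves an even number of interior
    vertices on the path. Hence the vertices of [D] are covered by disjoint
    paths of even order: the whole path for each matching edge of [G], the
    interior of the path for each other edge. So [D] has a perfect matching and
    [2 * nu D = n] ([spanning_subdivision_matching]).

    For the upper bound on [alpha D], let [A] be an independent set and let [J]
    be the set of branch vertices in [A]. The [2k] interior vertices of a
    subdivided edge contain at most [k] elements of [A], and at most [k - 1] if
    both ends are in [J] ([independent_path_count]). Summing up, [A] has at most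
    [|J| - e(J)] elements more than half of the number of subdividing vertices,
    where [e(J)] counts the edges of [G] inside [J]. A finite check shows that
    [|J| - e(J) <= n(G) / 2 - 1] for [K4] and [T], as [e(J)] pays for all but
    one vertex of each clique. Thus [2 * alpha D + 2 <= n].

    For the lower bound, delete the ends of an edge [xy] of a perfect matching.
    The remaining graph is KE of order [n - 2], and its matching number is at
    most [(n - 2) / 2], so its independence number, and with it [alpha D], is at
    least [(n - 2) / 2]. *)

Set Implicit Arguments.
Unset Strict Implicit.
Unset Printing Implicit Defensive.

(** * Sequences *)

Lemma path_of_infix (T : eqType) (e : rel T) (x : T) (s : seq T) :
  (forall y z, infix [:: y; z] (x :: s) -> e y z) -> path e x s.
Proof.
elim: s x => [//|y s IHs] x He /=; apply/andP; split.
  by apply: He; apply: prefix_infix; rewrite /= !eqxx prefix0s.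
by apply: IHs => z w zw; apply: He; rewrite infix_consl zw orbT.
Qed.

Lemma uniq_flatten_map (I T : eqType) (f : I -> seq T) (s : seq I) :
  uniq s -> {in s, forall i, uniq (f i)} ->
  {in s &, forall i j x, x \in f i -> x \in f j -> i = j} ->
  uniq (flatten (map f s)).
Proof.
elim: s => [//|i s IHs] /= /andP[i_s s_uniq] f_uniq f_disj.
rewrite cat_uniq f_uniq ?mem_head //= IHs //; last 2 first.
- by move=> j j_s; apply: f_uniq; rewrite inE j_s orbT.
- by move=> j k j_s k_s; apply: f_disj; rewrite inE ?j_s ?k_s orbT.
rewrite andbT; apply/hasPn => x /flatten_mapP[j j_s x_j].
apply/negP => x_i; move: i_s; rewrite (f_disj i j _ _ x) ?j_s ?mem_head //.
by rewrite inE j_s orbT.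
Qed.

(** * Matchings and independent sets *)

Lemma matching_cover_card (G : sgraph) (M : {set {set G}}) :
  matching M -> #|cover M| = (2 * #|M|)%N.
Proof.
move=> /andP[/forall_inP M_edge /eqP <-].
rewrite (eq_bigr (fun=> 2)) => [|e /M_edge]; first by rewrite sum_nat_const mulnC.
case/existsP=> x /existsP[y /andP[xy /eqP ->]].
by rewrite cards2; case: eqP xy => [->|//]; rewrite adj_irrefl.
Qed.

Lemma nu_le_half (G : sgraph) : 2 * nu G <= graph_order G.
Proof.
suff: nu G <= #|G| %/ 2 by rewrite /graph_order; lia.
apply/bigmax_leqP => M /matching_cover_card M_card.
by have := max_card (mem (cover M)); rewrite M_card; lia.
Qed.

Lemma perfect_matching_nu (G : sgraph) (M : {set {set G}}) :
  perfect_matching M -> 2 * nu G = graph_order G.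
Proof.
case/andP=> M_match /eqP M_cover; apply/eqP; rewrite eqn_leq nu_le_half /=.
have -> : graph_order G = 2 * #|M|.
  by rewrite -matching_cover_card // M_cover cardsT.
by rewrite leq_mul2l; apply: leq_bigmax_cond.
Qed.

Lemma alpha_delete (G : sgraph) (A : {set G}) : alpha (delete A) <= alpha G.
Proof.
apply/bigmax_leqP => B /forall_inP B_ind.
rewrite -(card_imset _ val_inj); apply: leq_bigmax_cond.
apply/forall_inP => _ /imsetP[x /B_ind /forall_inP x_ind ->].
by apply/forall_inP => _ /imsetP[y /x_ind xy ->].
Qed.

(** The order drops by two, hence the bound on the matching number drops by one;
    the KE equation turns this into a bound on the independence number. *)
Lemma alpha_ge_of_KE_deletion (G : sgraph) (x y : G) :
  adj x y -> KE (delete [set x; y]) -> graph_order G <= 2 * alpha G + 2.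
Proof.
move=> xy KExy.
have card_del : graph_order (delete [set x; y]) + 2 = #|G|.
  rewrite /graph_order /= card_sig -(cardsC [set x; y]) cards2.
  by case: eqP xy => [->|_ _]; [rewrite adj_irrefl | rewrite addnC].
move: (alpha_delete [set x; y]) (nu_le_half (delete [set x; y])) KExy card_del.
by rewrite /KE /graph_order; lia.
Qed.

(** * Pairing up a sequence of vertices *)

(** Consecutive vertices are adjacent two by two: first and second, third and
    fourth, and so on. Concatenating paths of even order gives such a sequence,
    although the end of a path need not be adjacent to the start of the next. *)
Fixpoint paired (G : sgraph) (s : seq G) : bool :=
  match s with
  | [::] => true
  | [:: _] => false
  | x :: y :: s' => adj x y && paired s'
  end.

Lemma paired_cat (G : sgraph) (s t : seq G) :
  paired s -> paired t -> paired (s ++ t).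
Proof.
have [n] := ubnP (size s); elim: n s => // n IHn [|x [|y s]] //= lt_sn.
by case/andP=> -> s_paired t_paired /=; apply: IHn => //; lia.
Qed.

Lemma paired_flatten (I : eqType) (G : sgraph) (f : I -> seq G) (s : seq I) :
  {in s, forall i, paired (f i)} -> paired (flatten (map f s)).
Proof.
elim: s => [//|i s IHs] f_paired /=.
apply: paired_cat; first by apply: f_paired; rewrite mem_head.
by apply: IHs => j j_s; apply: f_paired; rewrite inE j_s orbT.
Qed.

Lemma paired_path (G : sgraph) (x : G) (s : seq G) :
  path (@adj G) x s -> odd (size s) -> paired (x :: s).
Proof.
have [n] := ubnP (size s); elim: n x s => // n IHn x [|y [|z s]] //= lt_sn.
case/and3P=> -> yz z_s; rewrite /= negbK => s_odd.
by apply: (IHn z s) => //; lia.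
Qed.

Lemma paired_interior (G : sgraph) (x y : G) (s : seq G) :
  path (@adj G) x (rcons s y) -> ~~ odd (size s) -> paired s.
Proof.
case: s => [//|z s] /= /andP[_]; rewrite rcons_path => /andP[zs _].
by rewrite negbK; apply: paired_path.
Qed.

Lemma paired_matching (G : sgraph) (s : seq G) :
  uniq s -> paired s ->
  exists2 M : {set {set G}}, matching M & cover M = [set x in s].
Proof.
have [n] := ubnP (size s); elim: n s => // n IHn [|x [|y s]] //= lt_sn.
  move=> _ _; exists set0; last first.
    by rewrite /cover big_set0; apply/setP => x; rewrite !inE.
  apply/andP; split; first by apply/forall_inP => e; rewrite inE.
  by apply/trivIsetP => A B; rewrite inE.
rewrite inE negb_or => /and3P[/andP[x_y x_s] y_s s_uniq] /andP[xy s_paired].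
have [|M /andP[/forall_inP M_edge M_triv] M_cover] := IHn s _ s_uniq s_paired.
  by lia.
exists ([set x; y] |: M); last first.
  rewrite /cover bigcup_setU big_set1 -/(cover M) M_cover.
  by apply/setP => z; rewrite !inE orbA.
apply/andP; split.
  apply/forall_inP => e; rewrite inE => /orP[|/M_edge //].
  rewrite inE => /eqP ->; apply/existsP; exists x; apply/existsP; exists y.
  by rewrite xy eqxx.
apply: (trivIsetU1 _ M_triv _).1.
- move=> e e_M; apply/pred0P => z /=; apply/negP => /andP[z_xy z_e].
  have: z \in cover M by apply/bigcupP; exists e.
  rewrite M_cover inE; move: z_xy; rewrite !inE.
  by case/orP=> /eqP ->; apply/negP.
- apply/negP => /M_edge /existsP[u /existsP[v /andP[_ /eqP uv]]].
  by have := set21 u v; rewrite -uv inE.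
Qed.

(** * Spanning even subdivisions *)

Section Subdivision.

Variable G : sgraph.

(** [F] is a perfect matching of [G], [R] lists the other edges, and each edge
    occurs in exactly one of its two directions. *)
Definition oriented_edges (F R : seq (G * G)) : Prop :=
  [/\ uniq (F ++ R ++ [seq (e.2, e.1) | e <- F ++ R]),
      forall u v : G, adj u v =
        ((u, v) \in F ++ R) || ((v, u) \in F ++ R),
      uniq (flatten [seq [:: e.1; e.2] | e <- F])
    & forall u : G, u \in flatten [seq [:: e.1; e.2] | e <- F]].

Variables F R : seq (G * G).
Let V := flatten [seq [:: e.1; e.2] | e <- F].

(** A spanning even subdivision seen inside the host graph. The direction of the
    edges selects one of the two mutually reverse lists of new vertices, so that
    every vertex is listed exactly once. *)
Definition spanning_paths (K : sgraph) (b : G -> K) (p : G * G -> seq K) : Prop :=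
  perm_eq (map b V ++ flatten (map p (F ++ R))) (enum K) /\
  {in F ++ R, forall e, ~~ odd (size (p e)) /\
     path (@adj K) (b e.1) (rcons (p e) (b e.2))}.

Lemma spanning_paths_of_subdivision (K : sgraph) :
  oriented_edges F R -> has_spanning_even_subdivision G K ->
  exists b p, @spanning_paths K b p.
Proof.
case=> FR_uniq FR_adj V_uniq V_all [S [[b [p [b_inj p_path p_disj S_all S_adj]]]]].
case=> f [f_bij f_adj]; have f_inj := bij_inj f_bij.
rewrite catA cat_uniq in FR_uniq; case/and3P: FR_uniq => E_uniq /hasPn E_anti _.
have E_adj e : e \in F ++ R -> adj e.1 e.2.
  by case: e => u v uv; rewrite FR_adj uv.
exists (f \o b), (fun e => map f (p e.1 e.2)); split; last first.
  move=> [u v] uv /=; have uv_adj := E_adj _ uv.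
  have [p_even _ _ _] := p_path _ _ uv_adj.
  rewrite size_map -map_rcons; split=> //.
  rewrite path_map; apply: path_of_infix => x y xy; apply: f_adj.
  by apply/S_adj; exists u, v.
have -> : map (f \o b) V ++ flatten [seq map f (p e.1 e.2) | e <- F ++ R]
    = map f (map b V ++ flatten [seq p e.1 e.2 | e <- F ++ R]).
  by rewrite [RHS]map_cat [X in _ = _ ++ X]map_flatten -!map_comp.
have [g fK gK] := f_bij.
apply: uniq_perm; rewrite ?enum_uniq //; last first.
  move=> y; rewrite mem_enum -[y]gK mem_map // mem_cat.
  case: (S_all (g y)) => [[u ->]|[u [v [uv y_uv]]]].
    by rewrite (map_f b) ?V_all.
  apply/orP; right; apply/flatten_mapP.
  move: (uv); rewrite FR_adj => /orP[uv_E|vu_E]; first by exists (u, v).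
  by exists (v, u) => //=; have [_ _ -> _] := p_path _ _ uv; rewrite mem_rev.
rewrite (map_inj_uniq f_inj) cat_uniq (map_inj_uniq b_inj) V_uniq /=.
apply/andP; split.
  apply/hasPn => x /flatten_mapP[e /E_adj e_adj x_e]; apply/mapP => -[w _ xw].
  by have [_ _ _ /(_ w)] := p_path _ _ e_adj; rewrite -xw x_e.
apply: uniq_flatten_map => //.
  by move=> e /E_adj e_adj; have [_ ? _ _] := p_path _ _ e_adj.
move=> [u v] [u' v'] uv uv' x /= x_uv x_uv'.
have [//|uv'E] := p_disj _ _ _ _ (E_adj _ uv) (E_adj _ uv') x x_uv x_uv'.
suff: (u', v') \notin F ++ R by rewrite uv'.
by apply: E_anti; rewrite uv'E; apply/mapP; exists (u, v).
Qed.

Lemma spanning_subdivision_matching (K : sgraph) (b : G -> K) p :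
  spanning_paths b p -> exists M : {set {set K}}, perfect_matching M.
Proof.
case=> s_perm s_path.
(* The branch vertices are moved to the ends of the paths of the edges in F. *)
pose s := flatten [seq b e.1 :: rcons (p e) (b e.2) | e <- F]
            ++ flatten (map p R).
have s_enum : perm_eq s (enum K).
  apply: perm_trans s_perm; rewrite /s /V map_cat flatten_cat catA perm_cat2r.
  apply/permP => a; rewrite count_cat map_flatten.
  elim: F => [//|e F' IHF] /=.
  by rewrite !count_cat -cats1 !count_cat IHF /=; lia.
have s_uniq : uniq s by rewrite (perm_uniq s_enum) enum_uniq.
have s_paired : paired s.
  apply: paired_cat; apply: paired_flatten => e e_E.
    have [|e_even e_path] := s_path e; first by rewrite mem_cat e_E.
    by apply: paired_path => //; rewrite size_rcons.
  have [|e_even e_path] := s_path e; first by rewrite mem_cat e_E orbT.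
  exact: paired_interior e_path e_even.
have [M M_match M_cover] := paired_matching s_uniq s_paired.
exists M; rewrite /perfect_matching M_match M_cover /=.
by apply/eqP/setP => x; rewrite !inE (perm_mem s_enum) mem_enum.
Qed.

(** By induction, two interior vertices at a time. Each such pair contains at
    most one chosen vertex. If both ends are chosen, the first interior vertex
    is not: either the second one is not chosen, and this pair is lost, or it is,
    and the remaining path again has both ends chosen. *)
Lemma independent_path_count (K : sgraph) (a : pred K) (x y : K) (s : seq K) :
  (forall u v : K, adj u v -> ~~ (a u && a v)) ->
  path (@adj K) x (rcons s y) -> ~~ odd (size s) ->
  2 * (count a s + (a x && a y)) <= size s.
Proof.
move=> a_ind; have [n] := ubnP (size s).
elim: n x s => // n IHn x [|z [|w s]] //= lt_sn.
  by rewrite andbT => /a_ind/negbTE -> _.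
case/and3P=> xz zw w_s; rewrite negbK => s_even.
have {IHn w_s s_even} := IHn w s _ w_s s_even.
move: (a_ind _ _ xz) (a_ind _ _ zw).
by case: (a x) (a y) (a z) (a w) => [] [] [] [] //=; lia.
Qed.

(** If [a] selects the branch vertices of an independent set, then each edge
    with both ends in [a] costs the interior of its path one chosen vertex. *)
Lemma subdivision_alpha_bound (K : sgraph) (b : G -> K) p (d : nat) :
  spanning_paths b p ->
  (forall a : pred G,
     2 * count a V + d <= size V + 2 * count (fun e => a e.1 && a e.2) (F ++ R)) ->
  2 * alpha K + d <= graph_order K.
Proof.
move=> [s_perm s_path] G_bound.
suff A_bound (A : {set K}) : independent A -> 2 * #|A| + d <= #|K|.
  have [A A_ind ->] : {A : {set K} | independent A & alpha K = #|A|}.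
    apply: eq_bigmax_cond; apply/card_gt0P; exists set0.
    by apply/forall_inP => x; rewrite inE.
  exact: A_bound.
move=> /forall_inP A_ind; pose a := [pred x | x \in A].
have a_ind u v : adj u v -> ~~ (a u && a v).
  by move=> uv; apply/negP => /andP[/A_ind/forall_inP uA /uA]; rewrite uv.
have A_card : #|A| = count (a \o b) V + \sum_(e <- F ++ R) count a (p e).
  have -> : #|A| = count a (enum K).
    by rewrite cardE size_filter enumT.
  rewrite -(permP s_perm) count_cat count_map; congr addn.
  by rewrite count_flatten sumnE !big_map.
have K_card : #|K| = size V + \sum_(e <- F ++ R) size (p e).
  rewrite cardE -(perm_size s_perm) size_cat size_map; congr addn.
  by rewrite size_flatten sumnE !big_map.
have path_bound : 2 * (\sum_(e <- F ++ R) count a (p e)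
      + count (fun e => (a \o b) e.1 && (a \o b) e.2) (F ++ R))
    <= \sum_(e <- F ++ R) size (p e).
  rewrite -sum1_count [X in _ + X]big_mkcond -big_split big_distrr /= !big_seq.
  apply: leq_sum => e /s_path[e_even e_path].
  by have := independent_path_count a_ind e_path e_even; rewrite /=; case: andb.
by move: (G_bound (a \o b)) path_bound; rewrite A_card K_card; lia.
Qed.

End Subdivision.

(** The numerical hypothesis says that a set [J] of vertices of [G] satisfies
    [|J| - e(J) <= n(G) / 2 - 1]. By the bound for subdivisions, it forces
    [alpha] to be below half of the order of [D]; the KE deletions show that it
    is just one below. *)
Lemma alpha_nu_of_orientation (G D : sgraph) (v : G) (F R : seq (G * G)) :
  oriented_edges F R ->
  (forall a : pred G,
     2 * count a (flatten [seq [:: e.1; e.2] | e <- F]) + 2 <=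
     size (flatten [seq [:: e.1; e.2] | e <- F])
       + 2 * count (fun e => a e.1 && a e.2) (F ++ R)) ->
  has_spanning_even_subdivision G D -> KE_deletions D ->
  (alpha D).+1 = nu D.
Proof.
move=> FR_or G_bound D_sub D_KE.
have [b [p D_paths]] := spanning_paths_of_subdivision FR_or D_sub.
have alpha_ub := subdivision_alpha_bound D_paths G_bound.
have [M M_perfect] := spanning_subdivision_matching D_paths.
have nuD := perfect_matching_nu M_perfect.
have /andP[/andP[/forall_inP M_edge _] /eqP M_cover] := M_perfect.
have /bigcupP[e e_M _] : b v \in cover M by rewrite M_cover inE.
have /existsP[x /existsP[y /andP[xy /eqP e_xy]]] := M_edge e e_M.
have xy_KE : KE (delete [set x; y]).
  by apply: D_KE => //; exists M; rewrite -?e_xy.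
by have := alpha_ge_of_KE_deletion xy xy_KE; lia.
Qed.

(** * The two base graphs *)

Lemma K4_alpha_nu (D : sgraph) : Deming_K4 D -> (alpha D).+1 = nu D.
Proof.
case=> D_sub D_KE.
pose v0 : K4 := @Ordinal 4 0 isT; pose v1 : K4 := @Ordinal 4 1 isT.
pose v2 : K4 := @Ordinal 4 2 isT; pose v3 : K4 := @Ordinal 4 3 isT.
apply: (@alpha_nu_of_orientation K4 D v0 [:: (v0, v1); (v2, v3)]
  [:: (v0, v2); (v0, v3); (v1, v2); (v1, v3)]) => //; last first.
  move=> a /=.
  by case: (a v0) (a v1) (a v2) (a v3) => [] [] [] [].
split=> //.
  by move=> [[|[|[|[|//]]]] u_lt] [[|[|[|[|//]]]] v_lt].
by move=> [[|[|[|[|//]]]] u_lt].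
Qed.

Lemma T_alpha_nu (D : sgraph) : Deming_BP D -> (alpha D).+1 = nu D.
Proof.
case=> D_sub D_KE.
pose v0 : T := @Ordinal 6 0 isT; pose v1 : T := @Ordinal 6 1 isT.
pose v2 : T := @Ordinal 6 2 isT; pose v3 : T := @Ordinal 6 3 isT.
pose v4 : T := @Ordinal 6 4 isT; pose v5 : T := @Ordinal 6 5 isT.
apply: (@alpha_nu_of_orientation T D v0 [:: (v0, v1); (v2, v3); (v4, v5)]
  [:: (v0, v2); (v1, v2); (v3, v4); (v3, v5)]) => //; last first.
  move=> a /=.
  by case: (a v0) (a v1) (a v2) (a v3) (a v4) (a v5) => [] [] [] [] [] [].
split=> //.
  by move=> [[|[|[|[|[|[|//]]]]]] u_lt] [[|[|[|[|[|[|//]]]]]] v_lt].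
by move=> [[|[|[|[|[|[|//]]]]]] u_lt].
Qed.

Theorem theorem2p6 (D : sgraph) (hD : Deming D) :
  ((alpha D)%:Z = (nu D)%:Z - 1)%R.
Proof.
have D_eq : (alpha D).+1 = nu D.
  by case: hD; [apply: K4_alpha_nu | apply: T_alpha_nu].
by lia.
Qed.
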